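(* Let $\lambda/\mu$ be a skew shape with $|\lambda|=m+n$, $|\mu|=m\ge1$, $|\lambda/\mu|=n$. Let $\tilde T$ be a standard skew tableau of shape $\lambda/\mu$ with entries $1,\ldots,n$, let $T'$ be a standard tableau of shape $\mu$, and let $T$ be the standard tableau of shape $\lambda$ whose restriction to $\mu$ is $T'$ and whose restriction to $\lambda/\mu$ is $\tilde T$ with every entry increased by $m$. Let $c$ be the box of $T$ containing $m$ (an inner corner of $\lambda/\mu$). Let $v_T$ be any weight vector in $\mathbb{C}[S_{m+n}]$ (for the left action) with weight given by $T$. Then $\mathrm{jdt}_{(m,m+n)}\cdot v_T$ is a weight vector whose weight restricted to $S_{m+n-1}$ (i.e. its eigenvalues under $X_1,\ldots,X_{m+n-1}$) is given by the standard tableau with $m+n-1$ boxes obtained from the inner slide $\mathrm{jdt}_c(\tilde T)$ by adding $m-1$ to each entry and filling in the inner shape $\mu\setminus\{c\}$ with $1,\ldots,m-1$ as in $T'$.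
   Context: Boxes of diagrams are indexed (row, column), rows numbered top to bottom; the content of box $(i,j)$ is $j-i$. A tableau (straight or skew) is standard if its entries increase to the right along rows and down columns. **Inner slide.** An inner corner of $\lambda/\mu$ is a box $c$ of $\mu$ with no box of $\mu$ below it or to its right. For a standard skew tableau $\tilde T$ of shape $\lambda/\mu$ and an inner corner $c$, $\mathrm{jdt}_c(\tilde T)$ is obtained as follows: start with a hole at $c$; if the hole is at $(i,j)$, move the smaller of the entries at $(i+1,j)$ and $(i,j+1)$ (or the only one that exists) into the hole, creating a new hole at the position it left; repeat until there is no entry below or to the right of the hole. The result is a standard skew tableau with the same entries, with inner shape $\mu\setminus\{c\}$. **Weights.** The Jucys-Murphy elements in $\mathbb{C}[S_N]$ are $X_1=0$, $X_i=(1\ i)+\cdots+(i-1\ i)$. A weight vector in a representation of $S_N$ is a nonzero common eigenvector of $X_1,\ldots,X_N$; its weight is given by a standard tableau $T$ if $X_i$ acts on it by the content of the box of $T$ containing $i$, for every $i$. $\mathbb{C}[S_{m+n}]$ is considered with the left multiplication action, and $S_{m+n-1}\subset S_{m+n}$ is the subgroup fixing $m+n$. **Operators.** Let $\sigma_i=(i\ i+1)$. The operator $\tilde\varphi_i$ on any representation of $S_N$ is the linear operator defined on weight vectors $u$ as follows: with $d$ the eigenvalue of $X_i$ minus the eigenvalue of $X_{i+1}$ on $u$, $\tilde\varphi_iu=\frac{d\,\sigma_iu+u}{(d+1)(d-1)}$ if $d\ne\pm1$, and $\tilde\varphi_iu=-\frac12u$ if $d=\pm1$. (This is $\frac{\sigma_i(X_i-X_{i+1})+1}{(X_i-X_{i+1}+1)(X_i-X_{i+1}-1)}$,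 with common zeros of numerator and denominator cancelled.) The inner slide operator is $$\mathrm{jdt}_{(m,m+n)}=\tilde\varphi_{m+n-1}\tilde\varphi_{m+n-2}\cdots\tilde\varphi_{m+1}\tilde\varphi_m$$ (with $\tilde\varphi_m$ acting first). *)

(* Defs.v *)
From HB Require Import structures.
From mathcomp Require Import all_boot all_order all_algebra all_fingroup.
From mathcomp Require Import all_character.
From mathcomp Require Import boolp classical_sets.
Set Implicit Arguments.
Unset Strict Implicit.
Unset Printing Implicit Defensive.
Import GRing.Theory.

(* Boxes are (row, column) pairs counted from 0; contents are the same as when
   rows and columns are counted from 1. *)
Definition box : Type := (nat * nat)%type.

Definition content (b : box) : int := (b.2%:Z - b.1%:Z)%R.

Definition is_partition (lam : seq nat) : bool :=
  sorted geq lam && (0 \notin lam).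

Definition diagram (lam : seq nat) : pred box :=
  fun b => b.2 < nth 0 lam b.1.

Definition included (mu lam : seq nat) : Prop :=
  forall b, diagram mu b -> diagram lam b.

Definition skew_diagram (lam mu : seq nat) : pred box :=
  fun b => diagram lam b && ~~ diagram mu b.

(* Fillings are partial maps: the boxes of the shape are exactly those that
   carry an entry. *)
Definition filling : Type := box -> option nat.

Definition standard (D : pred box) (N : nat) (t : filling) : Prop :=
  [/\ forall b, isSome (t b) = D b,
      forall b x, t b = Some x -> 1 <= x <= N,
      forall x, 1 <= x <= N -> exists! b, t b = Some x,
      forall i j j' x y,
        j < j' -> t (i, j) = Some x -> t (i, j') = Some y -> x < y
    & forall i i' j x y,
        i < i' -> t (i, j) = Some x -> t (i', j) = Some y -> x < y].

(* The filling equal to t1 on the boxes of D, and elsewhere to t2 with every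
   entry increased by k. *)
Definition glue (D : pred box) (t1 : filling) (k : nat) (t2 : filling) :
    filling :=
  fun b => if D b then t1 b else omap (addn k) (t2 b).

Definition move_entry (src dst : box) (t : filling) : filling :=
  fun b => if b == dst then t src else if b == src then None else t b.

Fixpoint slide (fuel : nat) (hole : box) (t : filling) : filling :=
  if fuel is fuel'.+1 then
    let below := (hole.1.+1, hole.2) in
    let right := (hole.1, hole.2.+1) in
    match t below, t right with
    | Some x, Some y =>
        if x < y then slide fuel' below (move_entry below hole t)
        else slide fuel' right (move_entry right hole t)
    | Some _, None => slide fuel' below (move_entry below hole t)
    | None, Some _ => slide fuel' right (move_entry right hole t)
    | None, None => t
    end
  else t.

(* The inner slide of a skew tableau with n entries. Each step moves an entry
   that has not moved before, so n steps always suffice. *)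
Definition jdt (n : nat) (c : box) (t : filling) : filling := slide n c t.

(* The transposition (i j) of S_N, for letters i and j in {1, ..., N}; letter
   k is represented by the ordinal k - 1. *)
Definition transp (N i j : nat) : 'S_N :=
  match insub i.-1, insub j.-1 with
  | Some a, Some b => tperm a b
  | _, _ => 1%g
  end.

Local Open Scope ring_scope.

(* A matrix representation acts on row vectors from the right: g maps u to
   u *m rG g. Since mathcomp permutations compose from left to right
   ((s * t) x = t (s x)), this is a left action for the usual composition of
   permutations. In particular regular_repr, which sends the basis vector of s
   to that of s * t, is C[S_N] with left multiplication s |-> t \o s. *)
Definition JM (C : fieldType) (N d : nat)
    (rG : mx_representation C [set: 'S_N] d) (i : nat) : 'M[C]_d :=
  \sum_(1 <= j < i) rG (transp N j i).

Definition has_weight (C : fieldType) (N d : nat)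
    (rG : mx_representation C [set: 'S_N] d)
    (w : nat -> C) (u : 'rV[C]_d) : Prop :=
  u != 0 /\ forall i, (1 <= i <= N)%N -> u *m JM rG i = w i *: u.

Definition weight_vector (C : fieldType) (N d : nat)
    (rG : mx_representation C [set: 'S_N] d) (u : 'rV[C]_d) : Prop :=
  exists w, has_weight rG w u.

Definition weight_given_by (C : fieldType) (N d : nat)
    (rG : mx_representation C [set: 'S_N] d)
    (k : nat) (t : filling) (u : 'rV[C]_d) : Prop :=
  forall i b, (1 <= i <= k)%N -> t b = Some i ->
    u *m JM rG i = (content b)%:~R *: u.

Definition phi_value (C : fieldType) (d : nat) (S : 'M[C]_d)
    (a : C) (u : 'rV[C]_d) : 'rV[C]_d :=
  if (a == 1) || (a == -1) then - 2^-1 *: u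
  else ((a + 1) * (a - 1))^-1 *: (a *: (u *m S) + u).

Definition is_phi (C : fieldType) (N d : nat)
    (rG : mx_representation C [set: 'S_N] d) (i : nat) (F : 'M[C]_d) : Prop :=
  forall w u, has_weight rG w u ->
    u *m F = phi_value (rG (transp N i i.+1)) (w i - w i.+1) u.

(* Existence is phiP below. Uniqueness holds over the complex numbers, where
   the weight vectors span every representation. *)
Definition phi (C : fieldType) (N d : nat)
    (rG : mx_representation C [set: 'S_N] d) (i : nat) : 'M[C]_d :=
  xget 0 [set F | is_phi rG i F].

(* The product phi_(b-1) ... phi_(a+1) phi_a; on row vectors the leftmost
   matrix factor acts first. *)
Definition jdt_op (C : fieldType) (N d : nat)
    (rG : mx_representation C [set: 'S_N] d) (a b : nat) : 'M[C]_d :=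
  \big[mulmx/1%:M]_(a <= i < b) phi rG i.

Lemma phiP (C : closedFieldType) (N d : nat)
    (rG : mx_representation C [set: 'S_N] d) (i : nat) :
  (1 <= i < N)%N -> is_phi rG i (phi rG i).
Proof.
move=> /andP[i1 iN]; rewrite /phi; case: xgetP => [F -> //|noF]; exfalso.
pose D := JM rG i - JM rG i.+1.
pose S := rG (transp N i i.+1).
have [rs rsE] := closed_field_poly_normal (char_poly D).
pose us := undup rs.
pose E (k : 'I_(size us)) := eigenspace D us`_k.
pose M a : 'M[C]_d := if (a == 1) || (a == -1) then - 2^-1 *: 1%:M
  else ((a + 1) * (a - 1))^-1 *: (a *: S + 1%:M).
have ME a (u : 'rV[C]_d) : u *m M a = phi_value S a u.
  rewrite /M /phi_value; case: ifP => _; rewrite -scalemxAr ?mulmx1 //.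
  by rewrite mulmxDr -scalemxAr mulmx1.
have dxE : mxdirect (\sum_k E k).
  apply: mxdirect_sum_eigenspace => k l _ _ /eqP.
  by rewrite nth_uniq ?undup_uniq // => /eqP/val_inj.
apply: (noF (\sum_k
  proj_mx (E k) (\sum_(l | l != k) E l)%MS *m M us`_k)).
move=> w u [u0 wu]; set a := w i - w i.+1.
have uD : u *m D = a *: u.
  by rewrite mulmxBr !wu -?scalerBl ?i1 ?(ltnW iN).
have : a \in us.
  rewrite mem_undup -root_prod_XsubC.
  have := eigenvalue_root_char D a.
  rewrite rsE rootZ ?lead_coef_eq0 ?monic_neq0 ?char_poly_monic // => <-.
  by apply/eigenvalueP; exists u.
move=> /(nthP 0)[k0 ltk eqk]; pose k := Ordinal ltk.
have uEk : (u <= E k)%MS by apply/eigenspaceP; rewrite /= eqk.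
pose P l := proj_mx (E l) (\sum_(l' | l' != l) E l')%MS.
have cap0 l : (E l :&: \sum_(l' | l' != l) E l' = 0)%MS.
  by have /mxdirect_sumsP := dxE; apply.
have uPk : u *m P k = u by rewrite proj_mx_id.
have uPl l : l != k -> u *m P l = 0.
  move=> nlk; rewrite proj_mx_0 //; apply: submx_trans uEk _.
  by apply: (sumsmx_sup k); rewrite // eq_sym.
rewrite mulmx_sumr (bigD1 k) //= [X in _ + X]big1 => [|l nlk].
  by rewrite addr0 mulmxA uPk eqk ME.
by rewrite mulmxA uPl ?mul0mx.
Qed.

(* Main.v *)
Require Import Defs.
From HB Require Import structures.
From mathcomp Require Import all_boot all_order all_algebra all_fingroup.
From mathcomp Require Import all_character reals complex.
From mathcomp Require Import boolp zify.
Import GRing.Theory Num.Theory.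

(** Both sides of the statement are followed one operator at a time, on
    standard tableaux of the full straight shape [lam].

    In such a tableau the boxes of [i] and [i.+1] are either adjacent, so that
    their contents differ by exactly 1, or lie in different rows and columns,
    so that their contents differ by at least 2 ([consecutive_boxes]).  In the
    first case the operator [phi_i] only rescales a vector with these contents
    as weight ([phi_fixes_weight]).  In the second case it is an invertible
    intertwiner that exchanges the eigenvalues of [X_i] and [X_(i+1)]
    ([phi_swaps_weight]), and exchanging [i] and [i.+1] gives another standard
    tableau ([standard_swap]).

    The inner slide follows the same rule.  Start from [T], where the label [m]
    marks the hole [c], and apply the steps [i = m, m + 1, ...].  Before step
    [m + k], the entries [1, ..., k] of the skew tableau have had their chance
    to move and carry their value plus [m - 1], the later ones still carry
    their value plus [m], and the hole carries the label [m + k] in between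
    ([slid]).  If [m + k + 1] is not next to the hole, the two labels are
    exchanged: the hole stays, with its label raised by one ([slid_swap]).  If
    it is next to the hole, it is the smaller of the two neighbours of the hole
    since all smaller labels have been passed, so the slide moves it; the
    labels do not change at all, but the box of [m + k + 1] is now the hole
    ([slid_move], [slide_move]).  After the last step the hole is the box of
    [m + n], and removing that corner leaves the slid tableau
    ([standard_remove_max], [glue_slid]). *)

Set Implicit Arguments.
Unset Strict Implicit.
Unset Printing Implicit Defensive.

(** * Consecutive entries of standard tableaux *)

Definition swap (i x : nat) : nat :=
  if x == i then i.+1 else if x == i.+1 then i else x.

Lemma swapK i : involutive (swap i).
Proof. by move=> x; rewrite /swap; do !case: eqP; lia. Qed.

Lemma swap_bound i N x : 1 <= i < N -> (1 <= swap i x <= N) = (1 <= x <= N).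
Proof. by rewrite /swap; do !case: eqP; lia. Qed.

Lemma partition_antimono lam i j :
  is_partition lam -> i <= j -> nth 0 lam j <= nth 0 lam i.
Proof.
move=> /andP[lam_sorted _] le_ij.
have [lt_j|/(nth_default 0)->//] := ltnP j (size lam).
have geq_trans : transitive geq by move=> x y z /= xy yz; lia.
apply: (sorted_leq_nth geq_trans leqnn) => //; rewrite inE; lia.
Qed.

Lemma diagram_closed lam i j i' j' :
  is_partition lam -> i <= i' -> j <= j' ->
  diagram lam (i', j') -> diagram lam (i, j).
Proof.
rewrite /diagram /= => lamP le_i le_j lt_j'.
by have := partition_antimono lamP le_i; lia.
Qed.

Lemma standard_inj D N t x b b' :
  standard D N t -> t b = Some x -> t b' = Some x -> b = b'.
Proof.
move=> [_ bnd ex1 _ _] tb tb'.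
by have [b0 [_ b0P]] := ex1 x (bnd _ _ tb); rewrite -(b0P _ tb) -(b0P _ tb').
Qed.

Lemma standard_le lam N t i j i' j' x y :
  is_partition lam -> standard (diagram lam) N t ->
  i <= i' -> j <= j' -> t (i, j) = Some x -> t (i', j') = Some y -> x <= y.
Proof.
move=> lamP [dom _ _ row col] le_i le_j tx ty.
have : isSome (t (i, j')).
  by rewrite dom; apply: diagram_closed lamP le_i (leqnn _) _; rewrite -dom ty.
case tz: (t _) => [z|//] _.
apply: (@leq_trans z).
  move: le_j; rewrite leq_eqVlt => /predU1P[ej|lt_j].
    by move: tz; rewrite -ej tx => -[->].
  exact/ltnW/(row _ _ _ _ _ lt_j tx tz).
move: le_i; rewrite leq_eqVlt => /predU1P[ei|lt_i].
  by move: ty; rewrite -ei tz => -[->].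
exact/ltnW/(col _ _ _ _ _ lt_i tz ty).
Qed.

(** If the boxes are comparable, the path from [p] to [q] along a row and then
    a column has increasing entries between [i] and [i.+1], so it is a single
    step; this is where the straight shape is used.  The two remaining cases
    are those of boxes strictly south-west or north-east of one another. *)
Lemma consecutive_boxes lam N t p q i :
  is_partition lam -> standard (diagram lam) N t ->
  t p = Some i -> t q = Some i.+1 ->
  [\/ q = (p.1.+1, p.2), q = (p.1, p.2.+1),
      p.1 < q.1 /\ q.2 < p.2 | q.1 < p.1 /\ p.2 < q.2].
Proof.
case: p q => [a b] [a' b'] lamP tP tp tq /=.
have [dom _ _ row col] := tP.
have bxP z w : z <= a' -> w <= b' -> exists x, t (z, w) = Some x.
  move=> le_z le_w; have : isSome (t (z, w)).
    by rewrite dom; apply: diagram_closed lamP le_z le_w _; rewrite -dom tq.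
  by case: (t _) => // x _; exists x.
have [le_a|lt_a] := leqP a a'; last first.
  have [le_b|lt_b] := leqP b' b; last by apply: Or44.
  have := standard_le lamP tP (ltnW lt_a) le_b tq tp; lia.
have [le_b|lt_b] := leqP b b'; last first.
  have [e|lt_a] := eqVneq a a'; last by apply: Or43; lia.
  by subst a'; have := row _ _ _ _ _ lt_b tq tp; lia.
have [lt_a|ge_a] := ltnP a a'.
  have [z tz] := bxP a.+1 b lt_a le_b.
  have lt_z : i < z by apply: col tp tz.
  have le_z := standard_le lamP tP lt_a le_b tz tq.
  have e : z = i.+1 by lia.
  by apply: Or41; apply: (standard_inj tP tq); rewrite tz e.
have [lt_b|ge_b] := ltnP b b'.
  have [z tz] := bxP a b.+1 le_a lt_b.
  have lt_z : i < z by apply: row tp tz.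
  have le_z := standard_le lamP tP le_a lt_b tz tq.
  have e : z = i.+1 by lia.
  by apply: Or42; apply: (standard_inj tP tq); rewrite tz e.
have ea : a' = a by lia.
have eb : b' = b by lia.
by move: tq; rewrite ea eb tp => -[]; lia.
Qed.

(** Two entries of one row or column keep their order under the exchange
    unless they are [i] and [i.+1] themselves. *)
Lemma standard_swap D N t p q i :
  standard D N t -> t p = Some i -> t q = Some i.+1 ->
  p.1 != q.1 -> p.2 != q.2 ->
  standard D N (fun b => omap (swap i) (t b)).
Proof.
case: p q => [a b] [a' b'] /= tP tp tq ne_row ne_col.
have [dom bnd ex1 row col] := tP.
have iN : 1 <= i < N by have := bnd _ _ tp; have := bnd _ _ tq; lia.
have swapP (x : nat) (bx : box) :
    omap (swap i) (t bx) = Some x <-> t bx = Some (swap i x).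
  case: (t bx) => [y|] /=; split=> // -[].
    by move=> <-; rewrite swapK.
  by move=> ->; rewrite swapK.
have swap_lt x y : x < y -> (x, y) <> (i, i.+1) -> swap i x < swap i y.
  move=> lt_xy ne; have : ~ (x = i /\ y = i.+1).
    by move=> [ex ey]; apply: ne; rewrite ex ey.
  by rewrite /swap; do !case: eqP; lia.
split=> [bx|bx x /swapP/bnd|x||].
- by rewrite -dom; case: (t bx).
- by rewrite swap_bound.
- rewrite -(swap_bound x iN) => /ex1[bx [tbx bxP]].
  by exists bx; split=> [|bx' /swapP/bxP//]; apply/swapP.
- move=> k j j' x y lt_j /swapP tx /swapP ty.
  rewrite -(swapK i x) -(swapK i y); apply: swap_lt.
    exact: row lt_j tx ty.
  move=> [ex ey]; move: tx ty; rewrite ex ey => tx ty.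
  have [e1 _] := standard_inj tP tx tp.
  have [e2 _] := standard_inj tP ty tq.
  by rewrite -e1 -e2 eqxx in ne_row.
- move=> k k' j x y lt_k /swapP tx /swapP ty.
  rewrite -(swapK i x) -(swapK i y); apply: swap_lt.
    exact: col lt_k tx ty.
  move=> [ex ey]; move: tx ty; rewrite ex ey => tx ty.
  have [_ e1] := standard_inj tP tx tp.
  have [_ e2] := standard_inj tP ty tq.
  by rewrite -e1 -e2 eqxx in ne_col.
Qed.

(** * Adding an inner tableau and removing the largest entry *)

Lemma standard_glue lam mu m n Tt T' :
  is_partition mu -> included mu lam ->
  standard (skew_diagram lam mu) n Tt -> standard (diagram mu) m T' ->
  standard (diagram lam) (m + n) (glue (diagram mu) T' m Tt).
Proof.
move=> muP sub_mu [dom bnd ex1 row col] [dom' bnd' ex1' row' col'].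
have glueP b x : glue (diagram mu) T' m Tt b = Some x ->
    (diagram mu b /\ T' b = Some x) \/
    [/\ ~~ diagram mu b, m < x & Tt b = Some (x - m)].
  rewrite /glue; case: ifP => mub; first by left.
  case tb: (Tt b) => [y|//] /= -[<-]; right; have := bnd _ _ tb.
  by rewrite addKn; split=> //; lia.
split=> [b|b x /glueP[[_ /bnd']|[_ _ /bnd]]|x bx||]; rewrite /=; try lia.
- rewrite /glue; case: ifP => mub.
    by rewrite dom' mub; apply/esym/sub_mu.
  by have := dom b; rewrite /skew_diagram mub andbT; case: (Tt b).
- have [le_x|lt_x] := leqP x m.
    have [|b [tb bP]] := ex1' x; first lia.
    exists b; split=> [|b' /glueP[[_ /bP//]|[_]]]; last lia.
    by rewrite /glue -dom' tb.
  have [|b [tb bP]] := ex1 (x - m); first lia.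
  exists b; split=> [|b' /glueP[[_ /bnd']|[_ _ /bP//]]]; last lia.
  have /andP[_ /negbTE mub] : skew_diagram lam mu b by rewrite -dom tb.
  by rewrite /glue mub tb /= subnKC // ltnW.
- move=> i j j' x y lt_j.
  move=> /glueP[[mb tx]|[mb lt_x tx]] /glueP[[mb' ty]|[mb' lt_y ty]].
  + exact: row' lt_j tx ty.
  + by have := bnd' _ _ tx; lia.
  + have := diagram_closed muP (leqnn _) (ltnW lt_j) mb'.
    by rewrite (negbTE mb).
  + by have := row _ _ _ _ _ lt_j tx ty; lia.
- move=> i i' j x y lt_i.
  move=> /glueP[[mb tx]|[mb lt_x tx]] /glueP[[mb' ty]|[mb' lt_y ty]].
  + exact: col' lt_i tx ty.
  + by have := bnd' _ _ tx; lia.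
  + have := diagram_closed muP (ltnW lt_i) (leqnn _) mb'.
    by rewrite (negbTE mb).
  + by have := col _ _ _ _ _ lt_i tx ty; lia.
Qed.

Lemma nth_filter_nonzero s i :
  sorted geq s -> nth 0 (filter (predC1 0) s) i = nth 0 s i.
Proof.
have geq_trans : transitive geq by move=> x y z /= xy yz; lia.
elim: s i => //= a s IHs i s_path.
have s_sorted := path_sorted s_path.
have [a0|a_neq0] := eqVneq a 0; last by case: i => //= i; apply: IHs.
rewrite a0 /= in s_path *.
have /all_pred1P-> : all (pred1 0) s.
  by apply: sub_all (order_path_min geq_trans s_path) => x; rewrite /= leqn0.
rewrite filter_nseq /= nth_nil.
by case: i => //= i; rewrite nth_nseq if_same.
Qed.

Lemma sumn_filter_nonzero s : sumn (filter (predC1 0) s) = sumn s.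
Proof. by elim: s => //= a s IHs; case: eqP => [->|_] /=; rewrite IHs. Qed.

(** The largest entry sits at the end of its row and of its column.  When that
    row has a single box, shortening it leaves a part equal to 0, which must
    be filtered out to obtain a partition. *)
Lemma standard_remove_max lam N t p :
  is_partition lam -> sumn lam = N -> standard (diagram lam) N t ->
  t p = Some N ->
  exists nu, [/\ is_partition nu, sumn nu = N.-1 &
    standard (diagram nu) N.-1 (fun b => if b == p then None else t b)].
Proof.
case: p => [r s] lamP lamN tP tp.
have [dom bnd ex1 row col] := tP.
have not_right : ~~ diagram lam (r, s.+1).
  rewrite -dom; case tz: (t _) => [z|//].
  by have := row _ _ _ _ _ (ltnSn s) tp tz; have := bnd _ _ tz; lia.
have not_below : ~~ diagram lam (r.+1, s).
  rewrite -dom; case tz: (t _) => [z|//].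
  by have := col _ _ _ _ _ (ltnSn r) tp tz; have := bnd _ _ tz; lia.
rewrite [diagram _ _]/(s < nth 0 lam r.+1) in not_below.
have row_r : nth 0 lam r = s.+1.
  have : diagram lam (r, s) by rewrite -dom tp.
  by move: not_right; rewrite /diagram /=; lia.
have lt_r : r < size lam.
  by case: ltnP => // /(nth_default 0); lia.
pose s0 := set_nth 0 lam r s.
have nth_s0 i : nth 0 s0 i = if i == r then s else nth 0 lam i.
  by rewrite nth_set_nth.
have s0_sorted : sorted geq s0.
  apply/(sortedP 0) => i _; rewrite !nth_s0 /=.
  have := partition_antimono lamP (leqnSn i).
  by do !case: eqP => [?|?]; subst; lia.
pose nu := filter (predC1 0) s0.
have nuE b : diagram nu b = (b != (r, s)) && diagram lam b.
  rewrite /diagram nth_filter_nonzero // nth_s0; case: b => i j /=.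
  by rewrite xpair_eqE; case: eqP => [->|//] /=; rewrite row_r; lia.
exists nu; split.
- rewrite /is_partition mem_filter /= andbT; apply: sorted_filter => //.
  by move=> x y z /= xy yz; lia.
- by rewrite sumn_filter_nonzero sumn_set_nth_ltn // row_r lamN; lia.
have remP b x : (if b == (r, s) then None else t b) = Some x -> t b = Some x.
  by case: eqP.
split=> [b|b x|x xN|i j j' x y lt_j /remP tx /remP|
  i i' j x y lt_i /remP tx /remP].
- by rewrite nuE -dom; case: eqP.
- case: eqP => // ne tb; have := bnd _ _ tb.
  have : x <> N by move=> e; apply: ne; apply: (standard_inj tP tb); rewrite e.
  lia.
- have [|b [tb bP]] := ex1 x; first lia.
  exists b; split=> [|b' /remP/bP//]; case: eqP => // e.
  by move: tb; rewrite e tp => -[]; lia.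
- exact: row lt_j tx.
- exact: col lt_i tx.
Qed.

(** * The inner slide as a sequence of label exchanges *)

(** The hole carries the label that lies between the already treated entries,
    at most [k], and the later ones. *)
Definition slid (inner : pred box) (T' : filling) (m k : nat) (h : box)
    (t : filling) : filling :=
  fun b => if inner b then T' b else if b == h then Some (m + k)
    else omap (fun x => if x <= k then m.-1 + x else m + x) (t b).

(** The situation before step [m + k]: [t] is a stage of the slide with hole
    [h], and [inner] is the inner shape with its corner removed. *)
Definition slid_state (lam : seq nat) (inner : pred box) (T' : filling)
    (m n k : nat) (h : box) (t : filling) : Prop :=
  [/\ standard (diagram lam) (m + n) (slid inner T' m k h t),
      ~~ inner h, t h = None & forall b, inner b -> t b = None].

Section Slide.
Variables (lam : seq nat) (inner : pred box) (T' : filling) (m n k : nat).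
Variables (h q : box) (t : filling).
Let U := slid inner T' m k h t.
Hypothesis innerP : forall b x, inner b -> T' b = Some x -> x < m.
Hypothesis stP : slid_state lam inner T' m n k h t.
Hypothesis Uq : U q = Some (m + k).+1.

Lemma slid_large b y : U b = Some y -> m + k < y ->
  ~~ inner b /\ t b = Some (y - m).
Proof using innerP.
rewrite /U /slid; case: ifP => [ib /(innerP ib)|_]; first lia.
case: eqP => [_ []|_]; first lia.
case: (t b) => //= x [<-]; case: ifP => ? ?; split=> //; first lia.
by congr Some; lia.
Qed.

Lemma slid_hole : U h = Some (m + k).
Proof using stP.
by case: stP => _ /negbTE nh _ _; rewrite /U /slid nh eqxx.
Qed.

Lemma slid_next : ~~ inner q /\ t q = Some k.+1.
Proof using innerP Uq.
have [|? ->] := slid_large Uq; first lia.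
by split=> //; congr Some; lia.
Qed.

Lemma slid_neq : q != h.
Proof using stP Uq.
by apply/eqP => e; move: Uq; rewrite e slid_hole => -[]; lia.
Qed.

(** Apart from the hole, only the entry [k.+1] of [t] changes its status from
    later to treated, and this lowers its label to [m + k]. *)
Lemma slid_swap b : 0 < m ->
  slid inner T' m k.+1 h t b = omap (swap (m + k)) (U b).
Proof using innerP.
move=> m_gt0.
rewrite /U /slid; case: ifP => ib.
  case tb: (T' b) => [x|//] /=; have := innerP ib tb.
  by rewrite /swap; do !case: eqP => //; lia.
case: eqP => _; first by rewrite /= /swap eqxx addnS.
case: (t b) => [x|] //=; congr Some.
by do 2?case: ifP; rewrite /swap; do ?case: eqP; lia.
Qed.

(** The moved entry [k.+1] becomes a treated one, so its label in its new box
    is the one that the hole had there; the new hole takes over the label that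
    the moved entry had. *)
Lemma slid_move b : 0 < m ->
  slid inner T' m k.+1 q (move_entry q h t) b = U b.
Proof using innerP stP Uq.
move=> m_gt0.
have [nq tq] := slid_next; have [UP /negbTE nh th _] := stP.
have neq := slid_neq.
have [-> | b_q] := eqVneq b q.
  by rewrite Uq /slid (negbTE nq) eqxx addnS.
rewrite /U /slid /move_entry; case: ifP => // ib; rewrite (negbTE b_q).
case: eqP => [_|/eqP b_h]; first by rewrite tq /= leqnn; congr Some; lia.
case tb: (t b) => [x|//] /=; congr Some.
have x_neq : x <> k.+1.
  move=> e; case/eqP: b_q; apply: (standard_inj UP _ Uq).
  by rewrite /slid ib (negbTE b_h) tb e /= ltnn addnS.
by do 2!case: ifP => //; lia.
Qed.

(** Labels increase to the right of the hole and below it, so a neighbour of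
    the hole is an entry that has not been treated yet. *)
Lemma slid_after_hole b y :
  b = (h.1.+1, h.2) \/ b = (h.1, h.2.+1) -> t b = Some y ->
  k < y /\ U b = Some (m + y).
Proof using stP.
have [[_ _ _ row col] _ th t_inner] := stP; move=> b_nbr tb.
have Uh : U (h.1, h.2) = Some (m + k) by rewrite -surjective_pairing slid_hole.
have Ub : U b = Some (if y <= k then m.-1 + y else m + y).
  rewrite /U /slid tb; case: ifP => [/t_inner|_]; first by rewrite tb.
  by case: eqP => // e; move: tb; rewrite e th.
have : m + k < if y <= k then m.-1 + y else m + y.
  case: b_nbr Ub => -> Ub; first exact: col (ltnSn _) Uh Ub.
  exact: row (ltnSn _) Uh Ub.
by move: Ub; case: ifP => [le_yk _|_ Ub]; [lia|split=> //; lia].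
Qed.

(** The entry [k.+1] is the least untreated one, hence the smaller of the
    neighbours of the hole. *)
Lemma slide_move f : q = (h.1.+1, h.2) \/ q = (h.1, h.2.+1) ->
  slide f.+1 h t = slide f q (move_entry q h t).
Proof using innerP stP Uq.
have [_ tq] := slid_next; have [UP _ _ _] := stP.
have later b y : b = (h.1.+1, h.2) \/ b = (h.1, h.2.+1) ->
    t b = Some y -> b <> q -> k.+1 < y.
  move=> b_nbr tb b_q; have [lt_ky Ub] := slid_after_hole b_nbr tb.
  have : y <> k.+1.
    by move=> e; apply: b_q; apply: (standard_inj UP Ub); rewrite e addnS.
  lia.
move=> [] eq_q; rewrite /= -eq_q tq.
- case tr: (t _) => [y|] //.
  suff -> : k.+1 < y by [].
  by apply: (later _ _ (or_intror erefl) tr); rewrite eq_q => -[]; lia.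
- case tb: (t _) => [x|] //.
  suff lt_x : k.+1 < x by rewrite ltnNge ltnW.
  by apply: (later _ _ (or_introl erefl) tb); rewrite eq_q => -[]; lia.
Qed.

Lemma slid_state_move : 0 < m ->
  slid_state lam inner T' m n k.+1 q (move_entry q h t).
Proof.
move=> m_gt0; have [UP nh th t_inner] := stP; have [nq tq] := slid_next.
split=> // [||b ib].
- rewrite (_ : slid _ _ _ _ _ _ = U) //.
  by apply: funext => b; apply: slid_move.
- by rewrite /move_entry (negbTE slid_neq) eqxx.
- rewrite /move_entry; case: eqP => [e|_]; first by rewrite e (negbTE nh) in ib.
  by case: eqP => // _; apply: t_inner.
Qed.

Lemma slid_state_swap : 0 < m -> h.1 != q.1 -> h.2 != q.2 ->
  slid_state lam inner T' m n k.+1 h t.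
Proof.
have [UP nh th t_inner] := stP => m_gt0 ne_row ne_col; split=> //.
rewrite (_ : slid _ _ _ _ _ _ = fun b => omap (swap (m + k)) (U b)).
  exact: standard_swap UP slid_hole Uq ne_row ne_col.
by apply: funext => b; apply: slid_swap.
Qed.

End Slide.

(** Every entry has been treated, so the hole has no neighbour left. *)
Lemma slid_stop lam inner T' m n h t f :
  slid_state lam inner T' m n n h t -> slide f h t = t.
Proof.
move=> stP; have [[_ bnd _ _ _] _ _ _] := stP.
have stop b : b = (h.1.+1, h.2) \/ b = (h.1, h.2.+1) -> t b = None.
  move=> b_nbr; case tb: (t b) => [y|//].
  by have [lt_ny /bnd] := slid_after_hole stP b_nbr tb; lia.
by case: f => //= f; rewrite !stop; [|right|left].
Qed.

Lemma glue_slid lam inner T' m n h t :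
  slid_state lam inner T' m n n h t ->
  glue inner T' m.-1 t =
  fun b => if b == h then None else slid inner T' m n h t b.
Proof.
move=> [[_ bnd _ _ _] nh th _]; apply: funext => b; rewrite /glue.
have [-> | b_h] := eqVneq b h; first by rewrite (negbTE nh) th.
have := bnd b; rewrite /slid; case: ifP => // _; rewrite (negbTE b_h).
case: (t b) => [x|] //= /(_ _ erefl).
by case: ifP => // ? ?; congr Some; lia.
Qed.

Lemma slid_start lam mu m n Tt T' c :
  is_partition mu -> included mu lam ->
  standard (skew_diagram lam mu) n Tt -> standard (diagram mu) m T' ->
  T' c = Some m ->
  let inner := fun b => diagram mu b && (b != c) in
  slid inner T' m 0 c Tt = glue (diagram mu) T' m Tt /\
  slid_state lam inner T' m n 0 c Tt.
Proof.
move=> muP sub_mu TtP T'P T'c inner.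
have [dom bnd _ _ _] := TtP; have [dom' _ _ _ _] := T'P.
have mu_c : diagram mu c by rewrite -dom' T'c.
have Tt_mu b : diagram mu b -> Tt b = None.
  by move=> mu_b; have := dom b; rewrite /skew_diagram mu_b andbF; case: (Tt b).
have slidE : slid inner T' m 0 c Tt = glue (diagram mu) T' m Tt.
  apply: funext => b; rewrite /slid /glue /inner.
  have [->|b_c] := eqVneq b c; first by rewrite andbF mu_c addn0 T'c.
  rewrite andbT; case: ifP => // _; case tb: (Tt b) => [x|//] /=; congr Some.
  by have := bnd _ _ tb; case: ifP; lia.
split=> //; split; first by rewrite slidE; apply: standard_glue.
- by rewrite /inner eqxx andbF.
- exact: Tt_mu.
- by move=> b /andP[/Tt_mu].
Qed.

(** * Action of the operators on weight vectors *)

Local Open Scope ring_scope.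

Section JucysMurphy.
Variables (C : fieldType) (N d : nat).
Variable rG : mx_representation C [set: 'S_N] d.
Implicit Types (i j k : nat).

Lemma transpE (a b : 'I_N) : transp N a.+1 b.+1 = tperm a b.
Proof. by rewrite /transp /= !valK. Qed.

Lemma transpJ i j k : (1 <= i < N)%N -> (1 <= j <= N)%N -> (1 <= k <= N)%N ->
  (transp N j k ^ transp N i i.+1 = transp N (swap i j) (swap i k))%g.
Proof.
case: i j k => [|i] [|j] [|k] //= iN jN kN.
pose a := Ordinal (ltnW iN); pose b := Ordinal iN.
pose x := Ordinal jN; pose y := Ordinal kN.
have swapE (z : 'I_N) : swap i.+1 z.+1 = (tperm a b z).+1.
  rewrite /swap; case: tpermP => [->|->|za zb] /=; do ?[by do !case: eqP; lia].
  have : z <> i :> nat by move=> e; apply: za; apply: val_inj.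
  have : z <> i.+1 :> nat by move=> e; apply: zb; apply: val_inj.
  by do !case: eqP; lia.
by rewrite (swapE x) (swapE y) (transpE a b) (transpE x y) transpE tpermJ.
Qed.

Lemma transp_sq i : (1 <= i < N)%N ->
  rG (transp N i i.+1) *m rG (transp N i i.+1) = 1%:M.
Proof.
case: i => [|i] //= iN.
rewrite -repr_mxM ?inE // (transpE (Ordinal (ltnW iN)) (Ordinal iN)).
by rewrite tperm2 repr_mx1.
Qed.

Lemma JM_conj i k : (1 <= i < N)%N -> (1 <= k <= N)%N ->
  rG (transp N i i.+1) *m JM rG k *m rG (transp N i i.+1) =
  \sum_(1 <= j < k) rG (transp N (swap i j) (swap i k)).
Proof.
move=> iN kN; rewrite mulmx_sumr mulmx_suml; apply: eq_big_nat => j jk.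
rewrite -!repr_mxM ?inE // -transpJ //; last lia.
congr (rG _); rewrite [RHS]conjgE mulgA; congr (_ * _ * _)%g.
case: i iN {kN} => [|i] //= iN.
by rewrite (transpE (Ordinal (ltnW iN)) (Ordinal iN)) tpermV.
Qed.

Lemma JM_succ i : (1 <= i < N)%N ->
  JM rG i.+1 = rG (transp N i i.+1) *m JM rG i *m rG (transp N i i.+1)
               + rG (transp N i i.+1).
Proof.
move=> iN; rewrite JM_conj ?[JM rG i.+1]big_nat_recr //=; try lia.
congr (_ + _); apply: eq_big_nat => j ji.
have -> : swap i j = j by rewrite /swap; do !case: eqP; lia.
by rewrite /swap eqxx.
Qed.

(** Conjugation by [(i i+1)] permutes the summands of [X_k]: for [k > i.+1] the
    indices [i] and [i.+1] both occur and are exchanged. *)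
Lemma JM_comm i k : (1 <= i < N)%N -> (1 <= k <= N)%N -> k != i -> k != i.+1 ->
  rG (transp N i i.+1) *m JM rG k = JM rG k *m rG (transp N i i.+1).
Proof.
move=> iN kN k_i k_i1.
suff e : rG (transp N i i.+1) *m JM rG k *m rG (transp N i i.+1) = JM rG k.
  by rewrite -[LHS]mulmx1 -(transp_sq iN) mulmxA e.
rewrite JM_conj //.
have -> : swap i k = k by rewrite /swap (negbTE k_i) (negbTE k_i1).
have [lt_ki|] := ltnP k i.
  apply: eq_big_nat => j jk; congr (rG (transp _ _ _)).
  by rewrite /swap; do !case: eqP; lia.
rewrite leq_eqVlt eq_sym (negbTE k_i) /= => lt_ik.
have lt_i1k : (i.+1 < k)%N by lia.
rewrite /JM !(@big_cat_nat _ _ _ i 1 k) /=; try lia.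
rewrite ![in \sum_(i <= _ < k) _]big_ltn // ![\sum_(i.+1 <= _ < k) _]big_ltn //.
rewrite {2 3}/swap eqxx (gtn_eqF (ltnSn i)) eqxx.
congr (_ + _); last rewrite addrCA; last do 2!congr (_ + _).
  apply: eq_big_nat => j jk; congr (rG (transp _ _ _)).
  by rewrite /swap; do !case: eqP; lia.
apply: eq_big_nat => j jk; congr (rG (transp _ _ _)).
by rewrite /swap; do !case: eqP; lia.
Qed.

(** With [S] the simple transposition, [X] and [Y] the elements numbered [i]
    and [i.+1], the relations [S Y = X S + 1] and [S X = Y S - 1] hold, and they
    show that [a u S + u] has exchanged eigenvalues for [X] and [Y].  It is
    nonzero because [a u S = - u] would force [a ^+ 2 = 1], as [S] is an
    involution. *)
Lemma phi_swaps_weight i F w u : (1 <= i < N)%N -> is_phi rG i F ->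
  has_weight rG w u -> (w i - w i.+1) ^+ 2 != 1 ->
  has_weight rG (w \o swap i) (u *m F).
Proof.
move=> iN phiF uP a_sq; have [u0 uw] := uP.
set S := rG (transp N i i.+1); set a := w i - w i.+1.
have SS : S *m S = 1%:M by apply: transp_sq.
have uX : u *m JM rG i = w i *: u by apply: uw; lia.
have uY : u *m JM rG i.+1 = w i.+1 *: u by apply: uw; lia.
have SY : S *m JM rG i.+1 = JM rG i *m S + 1%:M.
  by rewrite JM_succ // mulmxDr !mulmxA SS mul1mx.
have SX : S *m JM rG i = JM rG i.+1 *m S - 1%:M.
  by rewrite JM_succ // mulmxDl -[_ *m S *m S]mulmxA SS mulmx1 addrK.
pose u1 := a *: (u *m S) + u.
have a_gen : (a == 1) || (a == -1) = false by rewrite -sqrf_eq1; apply: negbTE.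
have -> : u *m F = ((a + 1) * (a - 1))^-1 *: u1.
  by rewrite (phiF _ _ uP) /phi_value -/a a_gen.
have u1_neq0 : u1 != 0.
  apply: contraNneq a_sq => u1_0.
  have u1S : a *: u + u *m S = 0.
    by rewrite -[RHS](mul0mx _ S) -u1_0 mulmxDl -scalemxAl -mulmxA SS mulmx1.
  (* [u1 = 0] says [a u S = - u], and its image under [S] says [u S = - a u]. *)
  have e : a ^+ 2 *: u = u.
    rewrite -[RHS](addr0_eq u1_0) -(addr0_eq u1S).
    by rewrite scalerN opprK scalerA expr2.
  rewrite -subr_eq0; have /eqP := subrr u.
  rewrite -{1}e -{2}[u]scale1r -scalerBl.
  by rewrite scaler_eq0 (negbTE u0) orbF.
split=> [|k kN].
  rewrite scaler_eq0 negb_or u1_neq0 andbT invr_eq0.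
  by rewrite mulrC -subr_sqr_1 subr_eq0.
suff e : u1 *m JM rG k = w (swap i k) *: u1.
  by rewrite -scalemxAl e /= !scalerA mulrC.
rewrite mulmxDl -scalemxAl -mulmxA /swap.
have [->|k_i] := eqVneq k i.
  rewrite SX mulmxBr mulmxA uX uY mulmx1 -scalemxAl scalerBr scalerDr !scalerA.
  by rewrite -addrA -scaleNr -scalerDl mulrC /a opprB addrNK.
have [->|k_i1] := eqVneq k i.+1.
  rewrite SY mulmxDr mulmxA uX uY mulmx1 -scalemxAl !scalerDr !scalerA.
  by rewrite -addrA -scalerDl mulrC /a addrNK.
by rewrite JM_comm // mulmxA uw // -scalemxAl scalerDr !scalerA mulrC.
Qed.

Lemma phi_fixes_weight i F w u : 2 != 0 :> C -> is_phi rG i F ->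
  has_weight rG w u -> (w i - w i.+1) ^+ 2 = 1 -> has_weight rG w (u *m F).
Proof.
move=> two_neq0 phiF uP a_sq; have [u0 uw] := uP.
rewrite (phiF _ _ uP) /phi_value -sqrf_eq1 a_sq eqxx; split=> [|k kN].
  by rewrite scaler_eq0 negb_or u0 oppr_eq0 invr_eq0 two_neq0.
by rewrite -scalemxAl uw // !scalerA mulrC.
Qed.

End JucysMurphy.

(** * The slide operator follows the inner slide *)

HB.instance Definition _ (R : pzSemiRingType) (d : nat) :=
  Monoid.isLaw.Build 'M[R]_d 1%:M (@mulmx R d d d)
    (@mulmxA R d d d d) (@mul1mx R d d) (@mulmx1 R d d).

Lemma jdt_op_recr (C : fieldType) N d
    (rG : mx_representation C [set: 'S_N] d) a b :
  (a <= b)%N -> jdt_op rG a b.+1 = jdt_op rG a b *m phi rG b.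
Proof. by move=> le_ab; rewrite /jdt_op big_nat_recr. Qed.

Definition content_weight (C : nzRingType) (w : nat -> C) (t : filling) :
    Prop :=
  forall i b, t b = Some i -> w i = (content b)%:~R.

(** The content difference between the boxes of [m + k] and [m + k + 1] decides
    on both sides at once: whether [phi] fixes or swaps the weight, and whether
    the hole moves or stays.  The fuel [f] drops only when the hole moves, so
    at least [n - k] units remain. *)
Lemma jdt_op_follows_slide (C : numClosedFieldType) (d : nat) (lam : seq nat)
    (inner : pred box) (T' : filling) (m n : nat)
    (rG : mx_representation C [set: 'S_(m + n)] d)
    (h0 : box) (t0 : filling) (w0 : nat -> C) (v : 'rV[C]_d) (k : nat) :
  is_partition lam -> (forall b x, inner b -> T' b = Some x -> (x < m)%N) ->
  (0 < m)%N -> slid_state lam inner T' m n 0 h0 t0 ->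
  has_weight rG w0 v -> content_weight w0 (slid inner T' m 0 h0 t0) ->
  (k <= n)%N ->
  exists h t f w,
    [/\ slid_state lam inner T' m n k h t,
        (n - k <= f)%N /\ slide f h t = slide n h0 t0,
        has_weight rG w (v *m jdt_op rG m (m + k))
      & content_weight w (slid inner T' m k h t)].
Proof.
move=> lamP innerP m_gt0 st0 vP w0P.
elim: k => [|k IHk] kn.
  exists h0, t0, n, w0; split=> //; first by rewrite subn0.
  by rewrite addn0 /jdt_op big_geq // mulmx1.
have [h [t [f [w [stP [le_f slideE] uP wP]]]]] := IHk (ltnW kn).
have [UP _ _ _] := stP; have [_ _ ex1 _ _] := UP.
have [|q [Uq _]] := ex1 (m + k).+1; first lia.
have Uh := slid_hole stP.
have iN : (1 <= m + k < m + n)%N by lia.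
have phiF := @phiP C _ _ rG _ iN.
rewrite addnS jdt_op_recr ?leq_addr // mulmxA.
have wd : w (m + k)%N - w (m + k).+1 = (content h - content q)%:~R.
  by rewrite (wP _ _ Uh) (wP _ _ Uq) intrB.
have wd_sq : (((content h - content q) ^+ 2 == 1) =
    ((w (m + k)%N - w (m + k).+1) ^+ 2 == 1))%R.
  by rewrite wd -rmorphXn /= -[1 in RHS]/(1%:~R) eqr_int.
have adjacent : q = (h.1.+1, h.2) \/ q = (h.1, h.2.+1) ->
    (content h - content q) ^+ 2 = 1.
  by case=> ->; rewrite /content /=; lia.
have [q_adj|q_far] : (q = (h.1.+1, h.2) \/ q = (h.1, h.2.+1)) \/
    (h.1 < q.1 /\ q.2 < h.2 \/ q.1 < h.1 /\ h.2 < q.2)%N.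
  by have [] := consecutive_boxes lamP UP Uh Uq; tauto.
- case: f le_f slideE => [|f] le_f slideE; first lia.
  exists q, (move_entry q h t), f, w; split.
  + exact: slid_state_move.
  + by rewrite -(slide_move innerP stP Uq) //; split=> //; lia.
  + apply: phi_fixes_weight phiF uP _; first by rewrite pnatr_eq0.
    by apply/eqP; rewrite -wd_sq; apply/eqP/adjacent.
  + by move=> i b; rewrite (slid_move innerP stP Uq b m_gt0) => /wP.
- exists h, t, f, (w \o swap (m + k)); split.
  + by apply: (slid_state_swap innerP stP Uq); lia.
  + by split=> //; lia.
  + apply: phi_swaps_weight iN phiF uP _; rewrite -wd_sq.
    by apply/eqP; rewrite /content; nia.
  + move=> i b; rewrite (slid_swap _ _ _ innerP) //.
    case Ub: (slid _ _ _ _ _ _ _) => [x|] //= [<-].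
    by rewrite swapK; apply: wP.
Qed.

Theorem proposition4p3 (R : realType) (m n : nat) (lam mu : seq nat)
    (Tt T' T : filling) (c : box)
    (v : 'rV[R[i]]_#|[set: 'S_(m + n)]|) :
  let N := (m + n)%N in
  let rG := regular_repr R[i] [set: 'S_N] in
  let w := v *m jdt_op rG m N in
  let inner := fun b => diagram mu b && (b != c) in
  let S := glue inner T' m.-1 (jdt n c Tt) in
  is_partition lam -> is_partition mu -> included mu lam ->
  sumn lam = N -> sumn mu = m -> (1 <= m)%N ->
  standard (skew_diagram lam mu) n Tt ->
  standard (diagram mu) m T' ->
  T = glue (diagram mu) T' m Tt ->
  T c = Some m ->
  weight_vector rG v -> weight_given_by rG N T v ->
  [/\ exists nu, [/\ is_partition nu, sumn nu = N.-1
                   & standard (diagram nu) N.-1 S],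
      weight_vector rG w
    & weight_given_by rG N.-1 S w].
Proof.
move=> N rG w inner S lamP muP sub_mu lamN muN m_gt0 TtP T'P TE Tc.
move=> [w0 vP] v_given.
have [dom bnd _ _ _] := TtP; have [_ bnd' _ _ _] := T'P.
have T'c : T' c = Some m.
  move: Tc; rewrite TE /glue; case: ifP => // _.
  by case tc: (Tt c) => [x|//] /= [e]; have := bnd _ _ tc; lia.
have innerP b x : inner b -> T' b = Some x -> (x < m)%N.
  move=> /andP[_ b_c] tb; have := bnd' _ _ tb.
  have : x <> m.
    by move=> e; case/eqP: b_c; apply: (standard_inj T'P _ T'c); rewrite tb e.
  lia.
have [slidE st0] := slid_start muP sub_mu TtP T'P T'c.
have w0P : content_weight w0 (slid inner T' m 0 c Tt).
  rewrite slidE -TE => i b Tb; have [v0 vw] := vP.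
  have iN : (1 <= i <= N)%N.
    by have [+ _ _ _] := st0; rewrite slidE -TE => -[_ /(_ _ _ Tb)].
  have := v_given _ _ iN Tb; rewrite vw // => /eqP.
  by rewrite -subr_eq0 -scalerBl scaler_eq0 (negbTE v0) orbF subr_eq0 => /eqP.
have [h [t [f [w1 [stP [_ slideE] wP w1P]]]]] :=
  jdt_op_follows_slide lamP innerP m_gt0 st0 vP w0P (leqnn n).
have SE : S = fun b => if b == h then None else slid inner T' m n h t b.
  by rewrite /S /jdt -slideE (slid_stop _ stP) (glue_slid stP).
have [UP _ _ _] := stP.
split; last 1 first.
- move=> i b iN; rewrite SE; case: eqP => // _ /w1P <-.
  by have [_ ->] := wP; rewrite // /N; lia.
- by rewrite SE; apply: standard_remove_max UP (slid_hole stP).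
- by exists w1.
Qed.
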